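(* Let $n\geq 1$. For a finite simple connected graph $G$ let $s(G)$ be its sibling number and $t(G)$ its tuft number. Then the generating polynomial \[ \sum_{G} x^{s(G)}\,y^{t(G)}, \] where the sum is over all isomorphism classes (unlabeled graphs) $G$ of simple connected graphs with $n$ vertices, is symmetric in $x$ and $y$. Equivalently, the sibling number and the tuft number have joint symmetric distribution on unlabeled connected graphs with $n$ vertices.
   Context: All graphs are finite and simple. For a vertex $v$ of a graph $G$, its neighborhood is $N(v)=\{u : u \text{ adjacent to } v\}$ and its closed neighborhood is $N[v]=\{v\}\cup N(v)$. A leaf is a vertex of degree one. The tuft number $t(G)$ is the maximal number of leaves adjacent to a single vertex (it is $0$ if $G$ has no leaves). The sibling number is $s(G)=\max_{v\in V(G)}\lvert\{u\in V(G): N[u]=N[v]\}\rvert-1$. *)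

(* Defs.v *)
From mathcomp Require Import all_boot all_order all_fingroup.
Set Implicit Arguments. Unset Strict Implicit. Unset Printing Implicit Defensive.

Definition graph (n : nat) := {set 'I_n * 'I_n}.

Definition adj n (G : graph n) (u v : 'I_n) : bool := (u, v) \in G.

Definition simple_graph n (G : graph n) : bool :=
  [forall u, ~~ adj G u u] && [forall u, forall v, adj G u v == adj G v u].

Definition connected_graph n (G : graph n) : bool :=
  [forall u, forall v, connect (adj G) u v].

Definition nbhd n (G : graph n) (v : 'I_n) : {set 'I_n} := [set u | adj G v u].
Definition cnbhd n (G : graph n) (v : 'I_n) : {set 'I_n} := v |: nbhd G v.

Definition is_leaf n (G : graph n) (v : 'I_n) : bool := #|nbhd G v| == 1.

Definition tuft n (G : graph n) : nat :=
  \max_(v : 'I_n) #|[set u | adj G v u & is_leaf G u]|.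

Definition sibling n (G : graph n) : nat :=
  (\max_(v : 'I_n) #|[set u | cnbhd G u == cnbhd G v]|).-1.

Definition iso n (G H : graph n) : bool :=
  [exists p : {perm 'I_n}, [forall u, forall v, adj G u v == adj H (p u) (p v)]].

Definition count_classes (n a b : nat) : nat :=
  #|[set [set H : graph n | iso G H] | G in
      [set G : graph n | [&& simple_graph G, connected_graph G,
                             sibling G == a & tuft G == b]]]|.

(* Main.v *)
Require Import Defs.
From mathcomp Require Import all_boot all_order all_fingroup.
From mathcomp Require Import zify.
Set Implicit Arguments. Unset Strict Implicit. Unset Printing Implicit Defensive.

(** Let [F a b] count the isomorphism classes of connected graphs of order [n]
with sibling number at most [a] and tuft number at most [b]; it is enough that
[F a b = F b a]. In plethystic terms [F a b] is the coefficient of [x^n] in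
[Z_C [x - x^(a+2) - x^(b+2)]], where [Z_C] is the cycle index series of connected
graphs, and this is visibly symmetric. The signs are removed by allowing vertices
of a new colour and of weight [a+2]: replacing [a+1] of the closed twins of a
vertex, together with that vertex, by one coloured vertex, as often as possible,
is a bijection on isomorphism classes from all graphs onto the coloured graphs in
which uncoloured vertices have at most [a] uncoloured twins. Replacing a vertex
together with [b+1] of its leaves by a vertex of weight [b+2] does the same for
tufts. Applied to graphs that already use a set [S] of colours, the two steps
express the number of unrestricted graphs as the sum of the restricted numbers
for [S], [S + i], [S + j] and [S + i + j], with [i] and [j] new colours of
weights [a+2] and [b+2]. This recurrence does not distinguish [(a, b)] from
[(b, a)], and downward induction on [#|S|] gives the symmetry. *)

(** * Permutations from equal fibre sizes *)

(** Equal fibre sizes make the two tuples of values rearrangements of each other. The isomorphisms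
    below are obtained in this way, without matching individual twins or leaves by hand. *)
Lemma eq_fibre_perm n (L : eqType) (F F' : 'I_n -> L) :
  (forall l, #|[set u | F u == l]| = #|[set u | F' u == l]|) ->
  exists p : {perm 'I_n}, forall u, F' (p u) = F u.
Proof.
move=> eqF.
have /tuple_permP [p Hp] : perm_eq [tuple F i | i < n] [tuple F' i | i < n].
  have cE (f : 'I_n -> L) l : count_mem l [tuple f i | i < n] = #|[set u | f u == l]|.
    by rewrite /= count_map cardsE cardE /enum_mem size_filter count_filter -enumT; apply: eq_count => i /=; rewrite andbT.
  by apply/allP => l _; rewrite /= !cE eqF.
exists p => u.
have /(congr1 (fun s : n.-tuple L => tnth s u)) := val_inj Hp.
by rewrite !tnth_mktuple.
Qed.

(** The fibre sizes add up to [n], so the one at [l0] is determined by the others. *)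
Lemma eq_fibre_perm_but n (L : finType) (l0 : L) (F F' : 'I_n -> L) :
  (forall l, l != l0 -> #|[set u | F u == l]| = #|[set u | F' u == l]|) ->
  exists p : {perm 'I_n}, forall u, F' (p u) = F u.
Proof.
move=> eqF; apply: eq_fibre_perm => l.
have [->|] := eqVneq l l0; last exact: eqF.
have tot (f : 'I_n -> L) : \sum_l #|[set u | f u == l]| = n.
  rewrite -[RHS]card_ord -sum1_card (partition_big f predT) //=.
  by apply: eq_bigr => i _; rewrite -sum1dep_card.
have := tot F; rewrite -[in RHS](tot F') (bigD1 l0) //= [RHS](bigD1 l0) //=.
by rewrite (eq_bigr _ eqF) => /addIn.
Qed.

(** * Counting equivalence classes *)

Definition nclass (T : finType) (e : rel T) (P : pred T) : nat :=
  #|[set [set y | e x y] | x in [set x | P x]]|.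

(** Sending the class of [x] to the class of some [R]-partner is injective, because [R] reflects
    equivalence. [R] need not be functional, which suits collapses, where many choices are
    possible. *)
Lemma nclass_le (T1 T2 : finType) (e1 : rel T1) (e2 : rel T2)
    (P : pred T1) (Q : pred T2) (R : T1 -> T2 -> Prop) :
    equivalence_rel e1 -> equivalence_rel e2 ->
    (forall x, P x -> exists2 y, Q y & R x y) ->
    (forall x1 x2 y1 y2, P x1 -> P x2 -> Q y1 -> Q y2 ->
       R x1 y1 -> R x2 y2 -> e2 y1 y2 -> e1 x1 x2) ->
  nclass e1 P <= nclass e2 Q.
Proof.
move=> eq1 eq2 tot refl.
have classE (T : finType) (e : rel T) : equivalence_rel e ->
    forall x y, ([set z | e x z] == [set z | e y z]) = e x y.
  move=> eqe x y; apply/eqP/idP => [/setP /(_ y)|exy].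
    by rewrite !inE (eqe y y y).1.
  by apply/setP => z; rewrite !inE ((eqe x y z).2 exy).
pose P' := [set x | P x]; pose c1 x := [set z | e1 x z].
have rP A : A \in c1 @: P' -> exists x, P x && (A == c1 x).
  by case/imsetP => x; rewrite inE => Px ->; exists x; rewrite Px eqxx.
pose CT := {A : {set T1} | A \in c1 @: P'}.
(* One representative and one partner of it are fixed for every class, by choice over the finite
   type [CT] of classes. *)
have /fin_all_exists2 [f Qf Rf] : forall C : CT, exists2 y, Q y &
    exists2 x, P x /\ val C = c1 x & R x y.
  case=> A HA; have [x /andP[Px /eqP Ax]] := rP A HA.
  by have [y Qy Rxy] := tot x Px; exists y => //; exists x.
have <- : #|[set: CT]| = nclass e1 P by rewrite cardsT card_sig; apply: eq_card.
rewrite /nclass -(@card_in_imset _ _ (fun C : CT => [set z | e2 (f C) z])).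
  apply/subset_leq_card/subsetP => _ /imsetP [C _ ->].
  by apply: imset_f; rewrite inE.
move=> C D _ _ /eqP; rewrite classE // => e2CD; apply: val_inj.
have [x [Px ->] Rx] := Rf C; have [y [Py ->] Ry] := Rf D.
by apply/eqP; rewrite classE //; apply: (refl _ _ _ _ Px Py (Qf C) (Qf D) Rx Ry).
Qed.

Lemma nclass_ext (T : finType) (e : rel T) (P Q : pred T) :
  P =1 Q -> nclass e P = nclass e Q.
Proof.
by move=> PQ; rewrite /nclass; have -> : [set x | P x] = [set x | Q x] by apply/setP=> x; rewrite !inE PQ.
Qed.

(** The hypothesis says that no class meets both [Q1] and [Q2], so the two sets of classes are
    disjoint. *)
Lemma nclassU (T : finType) (e : rel T) (P Q1 Q2 : pred T) : equivalence_rel e ->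
    (forall x y, e x y -> Q1 x -> ~~ Q2 y) ->
  nclass e (fun x => P x && (Q1 x || Q2 x)) =
  nclass e (fun x => P x && Q1 x) + nclass e (fun x => P x && Q2 x).
Proof.
move=> eqe Q12; rewrite /nclass.
set c := fun x => _; set A := c @: _; set A1 := c @: _; set A2 := c @: _.
have -> : A = A1 :|: A2.
  rewrite -imsetU; apply: (congr1 (fun X : {set T} => c @: X)).
  by apply/setP => x; rewrite !inE andb_orr.
rewrite cardsU; suff -> : A1 :&: A2 = set0 by rewrite cards0 subn0.
apply/setP => C; rewrite !inE; apply/negP.
case/andP => /imsetP [x]; rewrite inE => /andP [_ Q1x] -> /imsetP [y].
rewrite inE => /andP [_ Q2y] /(congr1 (fun C : {set T} => y \in C)).
rewrite !inE (eqe y y y).1 => /(Q12 _ _) /(_ Q1x).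
by rewrite Q2y.
Qed.

Lemma nclass0 (T : finType) (e : rel T) (P : pred T) :
  (forall x, ~~ P x) -> nclass e P = 0.
Proof.
move=> P0; apply/eqP; rewrite /nclass cards_eq0 -subset0.
by apply/subsetP => C /imsetP [x]; rewrite inE (negPf (P0 x)).
Qed.

(* A coloured graph whose vertex set is a subset of ['I_n], so that isomorphisms
are permutations of ['I_n]: the colour [None] marks labels that are not vertices,
[Some None] uncoloured vertices (of weight 1), [Some (Some k)] vertices of colour [k]. *)
Definition cgraph (n : nat) (K : finType) : finType :=
  (graph n * {ffun 'I_n -> option (option K)})%type.

(** * Coloured graphs and the collapse relation *)

Section ColouredGraphs.
Variables (n : nat) (K : finType) (wt : K -> nat).
Implicit Types (g h : cgraph n K) (tw : bool) (u v w : 'I_n).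

Definition plain g v := g.2 v == Some None.

Definition colour_weight (c : option (option K)) :=
  match c with None => 0 | Some None => 1 | Some (Some k) => wt k end.

Definition ciso g h := [exists p : {perm 'I_n}, forall u,
  (g.2 u == h.2 (p u)) && [forall v, adj g.1 u v == adj h.1 (p u) (p v)]].

(* The weights add up to [n], the number of available labels: this leaves exactly
enough unused labels to undo every collapse below. *)
Definition good g :=
  [&& simple_graph g.1,
      [forall u, forall v, adj g.1 u v ==> (g.2 u != None)],
      [forall u, forall v, (g.2 u != None) ==> (g.2 v != None) ==> connect (adj g.1) u v]
    & \sum_u colour_weight (g.2 u) == n].

Definition used g := [set k | [exists v, g.2 v == Some (Some k)]].

(* [tw] selects between closed twins ([u] is a twin of [v]) and leaves ([u] is a
leaf attached to [v]); the two cases run in parallel throughout. *)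
Definition link tw g u v :=
  if tw then (u != v) && (cnbhd g.1 u == cnbhd g.1 v) else nbhd g.1 u == [set v].

(** Since [link] excludes [v] itself, on uncoloured simple graphs these are the bounds
    [sibling G <= m] and [tuft G <= m]. Coloured twins and coloured leaves are not counted. *)
Definition lim tw m g :=
  [forall v, plain g v ==> (#|[set u | plain g u & link tw g u v]| <= m)].

(* [g'] arises from [g] by collapsing groups of [m.+2] uncoloured vertices to one
vertex of the new colour [k]; [o u = Some v] means that [u] is absorbed by [v]. *)
Record collapse tw m (k : K) g g' (o : 'I_n -> option 'I_n) : Prop := Collapse {
  collapse_owned : forall u v, o u = Some v ->
    [/\ plain g u, g'.2 u = None, plain g v, g'.2 v = Some (Some k) & link tw g u v];
  collapse_free : forall u, o u = None ->
    g'.2 u = Some (Some k) /\ plain g u \/ g'.2 u = g.2 u /\ g.2 u <> Some (Some k);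
  collapse_restr : forall u w,
    adj g'.1 u w = [&& o u == None, o w == None & adj g.1 u w];
  collapse_fibre : forall v, g'.2 v = Some (Some k) -> #|[set u | o u == Some v]| = m.+1 }.

(* The adjacency of [g] recovered from a collapse [g'] of [g]. *)
Definition expand_adj tw g' (o : 'I_n -> option 'I_n) u w :=
  let r u := odflt u (o u) in
  if tw then (u != w) && ((r u == r w) || adj g'.1 (r u) (r w))
  else [|| o u == Some w, o w == Some u | adj g'.1 u w].

Lemma cisoP g h : reflect (exists p : {perm 'I_n},
  (forall u, g.2 u = h.2 (p u)) /\ (forall u v, adj g.1 u v = adj h.1 (p u) (p v)))
  (ciso g h).
Proof.
apply: (iffP existsP) => -[p Hp]; exists p.
  split=> [u|u v]; first by have /andP[/eqP] := forallP Hp u.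
  by have /andP[_ /forallP /(_ v) /eqP] := forallP Hp u.
case: Hp => Hc Ha; apply/forallP => u; rewrite Hc eqxx /=.
by apply/forallP => v; rewrite Ha.
Qed.

Lemma ciso_equiv : equivalence_rel ciso.
Proof.
have refl g : ciso g g by apply/cisoP; exists 1%g; split=> *; rewrite !perm1.
have sym g h : ciso g h -> ciso h g.
  case/cisoP => p [pc pa]; apply/cisoP; exists p^-1%g.
  by split=> [u|u v]; rewrite ?pc ?pa !permKV.
have trans g h l : ciso g h -> ciso h l -> ciso g l.
  case/cisoP => p [pc pa] /cisoP [q [qc qa]]; apply/cisoP; exists (p * q)%g.
  by split=> [u|u v]; rewrite ?pc ?pa !permM.
move=> g h l; split=> // gh; apply/idP/idP; last exact: trans.
exact/trans/sym.
Qed.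

Lemma simpleP (G : graph n) :
  reflect ((forall u, adj G u u = false) /\ symmetric (adj G)) (simple_graph G).
Proof.
apply: (iffP andP) => -[].
  move=> /forallP irr /forallP sym; split=> [u|u v]; first exact/negbTE/irr.
  exact/eqP/(forallP (sym u) v).
move=> irr sym; split; first by apply/forallP => u; rewrite irr.
by apply/forallP => u; apply/forallP => v; rewrite sym.
Qed.

Lemma goodP g : reflect
  [/\ simple_graph g.1, (forall u v, adj g.1 u v -> g.2 u <> None),
      (forall u v, g.2 u <> None -> g.2 v <> None -> connect (adj g.1) u v)
    & \sum_u colour_weight (g.2 u) = n] (good g).
Proof.
apply: (iffP and4P) => -[s a c w]; split=> //; try exact/eqP.
- by move=> u v uv; have /implyP /(_ uv) /eqP := forallP (forallP a u) v.
- move=> u v /eqP pu /eqP pv.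
  by have /implyP /(_ pu) /implyP /(_ pv) := forallP (forallP c u) v.
- by apply/forallP => u; apply/forallP => v; apply/implyP => /a /eqP.
- apply/forallP => u; apply/forallP => v; apply/implyP => /eqP pu.
  by apply/implyP => /eqP pv; apply: c.
Qed.

Lemma in_nbhd (G : graph n) u v : (u \in nbhd G v) = adj G v u.
Proof. by rewrite inE. Qed.

Lemma in_cnbhd (G : graph n) u v : (u \in cnbhd G v) = (u == v) || adj G v u.
Proof. by rewrite !inE. Qed.

Lemma cnbhd_sym (G : graph n) u v : simple_graph G ->
  (u \in cnbhd G v) = (v \in cnbhd G u).
Proof. by case/simpleP => _ sym; rewrite !in_cnbhd sym eq_sym. Qed.

Lemma link_irr tw g u : simple_graph g.1 -> link tw g u u = false.
Proof.
case/simpleP => irr _; case: tw; rewrite /link ?eqxx //.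
by apply/eqP => /setP /(_ u); rewrite in_nbhd irr inE eqxx.
Qed.

Lemma link_adj tw g u v : simple_graph g.1 -> link tw g u v -> adj g.1 u v.
Proof.
move=> sg; case: tw => /=.
  case/andP => /negPf uv /eqP /setP /(_ v).
  by rewrite !in_cnbhd eqxx eq_sym uv.
by move=> /eqP /setP /(_ v); rewrite in_nbhd inE eqxx.
Qed.

Lemma connect_homo (T : finType) (e e' : rel T) (r : T -> T) :
  (forall x y, e x y -> connect e' (r x) (r y)) ->
  forall x y, connect e x y -> connect e' (r x) (r y).
Proof.
move=> er x y /connectP [p]; elim: p x => [|z p IH] x /=; first by move=> _ ->.
by case/andP => /er xz /IH /[apply]; apply: connect_trans.
Qed.

(** * What a collapse preserves *)

Section Collapse.
Variables (tw : bool) (m : nat) (k : K) (g g' : cgraph n K) (o : 'I_n -> option 'I_n).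
Hypotheses (sg : simple_graph g.1) (C : collapse tw m k g g' o).

Let r u := odflt u (o u).

(** An owner has colour [k] in [g'] and an absorbed vertex has no colour there, so ownership never
    chains. *)
Lemma owner_free u v : o u = Some v -> o v = None.
Proof.
move=> uv; case ov: (o v) => [w|//].
have [_ c1 _ _ _] := collapse_owned C ov.
by have [_ _ _ c2 _] := collapse_owned C uv; rewrite c2 in c1.
Qed.

Lemma repr_free u : o (r u) = None.
Proof. by rewrite /r; case ou: (o u) => [v|] //=; apply: owner_free ou. Qed.

Lemma simple_collapse : simple_graph g'.1.
Proof.
have [irr sym] := simpleP _ sg; apply/simpleP; split=> [u|u v].
  by rewrite (collapse_restr C) irr !andbF.
by rewrite !(collapse_restr C) sym andbCA.
Qed.

Lemma present_free u : g'.2 u <> None -> o u = None.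
Proof. by case ou: (o u) => [v|//]; have [_ ->] := collapse_owned C ou. Qed.

Lemma present_repr u : g.2 u <> None -> g'.2 (r u) <> None.
Proof.
rewrite /r; case ou: (o u) => [v|] /=; first by have [_ _ _ -> _] := collapse_owned C ou.
by case: (collapse_free C ou) => [[-> _]|[-> _]].
Qed.

Lemma present_collapse u : g'.2 u <> None -> g.2 u <> None.
Proof.
move=> pu; case: (collapse_free C (present_free pu)) => [[_ /eqP ->]//|[<- //]].
Qed.

Lemma plain_kept u : plain g' u -> [/\ o u = None, plain g u & forall w, o w <> Some u].
Proof.
move=> /eqP pu; have ou : o u = None by apply: present_free; rewrite pu.
split=> // [|w ow]; last by have [_ _ _ c _] := collapse_owned C ow; rewrite pu in c.
by case: (collapse_free C ou) => [[] //|[E _]]; rewrite /plain -E pu.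
Qed.

Lemma twin_repr u : tw -> cnbhd g.1 (r u) = cnbhd g.1 u.
Proof.
rewrite /r => tw1; case ou: (o u) => [v|] //=; have := collapse_owned C ou.
by rewrite /link tw1 => -[_ _ _ _ /andP [_ /eqP]].
Qed.

(** An absorbed twin has the closed neighborhood of its owner, and an absorbed leaf has its owner as
    only neighbor, so [g'] and [o] determine the edges of [g]. *)
Lemma collapse_adjE u w : adj g.1 u w = expand_adj tw g' o u w.
Proof.
have [irr sym] := simpleP _ sg.
have cE x y : adj g.1 x y = (x != y) && (y \in cnbhd g.1 x).
  by rewrite in_cnbhd eq_sym; case: eqVneq => //= ->; rewrite irr.
rewrite /expand_adj; case twE: tw.
  have tr x : cnbhd g.1 x = cnbhd g.1 (r x) by rewrite twin_repr ?twE.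
  rewrite cE tr cnbhd_sym // tr cnbhd_sym // in_cnbhd.
  by rewrite (collapse_restr C) !repr_free !eqxx /= [r w == _]eq_sym.
have lnk x y : o x = Some y -> forall z, adj g.1 x z = (z == y).
  move=> ox z; have [_ _ _ _] := collapse_owned C ox.
  by rewrite /link twE => /eqP /setP /(_ z); rewrite in_nbhd inE.
case ou: (o u) => [v|].
  rewrite (lnk _ _ ou) (collapse_restr C) ou /= orbF.
  case ow: (o w) => [z|]; last by rewrite orbF; apply/eqP/eqP => [->|[->]].
  have -> : (Some z == Some u) = false.
    by apply/eqP => -[zu]; have := owner_free ow; rewrite zu ou.
  by rewrite orbF; apply/eqP/eqP => [->|[->]].
case ow: (o w) => [z|]; last by rewrite (collapse_restr C) ou ow.
by rewrite sym (lnk _ _ ow) (collapse_restr C) ou ow /= orbF; apply/eqP/eqP => [->|[->]].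
Qed.

Lemma collapse_adj_repr u w : adj g.1 u w -> r u = r w \/ adj g'.1 (r u) (r w).
Proof.
rewrite collapse_adjE /expand_adj; case: tw.
  by case/andP => _ /orP [/eqP|]; [left|right].
case/or3P => [/eqP ou|/eqP ow|a]; first by left; rewrite /r ou /= (owner_free ou).
  by left; rewrite /r ow /= (owner_free ow).
have := a; rewrite (collapse_restr C) => /and3P [/eqP ou /eqP ow _].
by right; rewrite /r ou ow.
Qed.

Lemma adj_repr u : connect (adj g.1) u (r u).
Proof.
rewrite /r; case ou: (o u) => [v|] //=; apply: connect1.
by have [_ _ _ _ /(link_adj sg)] := collapse_owned C ou.
Qed.

(** Label by label, a recoloured vertex gains [m.+1] and an absorbed one loses 1. Grouping the
    absorbed vertices by owner shows that gains and losses cancel. *)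
Lemma weight_collapse : wt k = m.+2 ->
  \sum_u colour_weight (g.2 u) = \sum_u colour_weight (g'.2 u).
Proof.
move=> wk; pose fr u := g'.2 u == Some (Some k).
suff E : \sum_u colour_weight (g.2 u) + \sum_u fr u * m.+1 =
         \sum_u colour_weight (g'.2 u) + \sum_u (o u != None).
  suff F : \sum_u (o u != None) = \sum_u fr u * m.+1 by move: E; rewrite F => /addIn.
  have -> : \sum_u (o u != None) = \sum_(u | o u != None) 1.
    by rewrite [RHS]big_mkcond; apply: eq_bigr => u _; case: (o u).
  transitivity (\sum_(v | fr v) \sum_(u | o u == Some v) 1); last first.
    rewrite big_mkcond /=; apply: eq_bigr => v _; rewrite /fr; case: eqP => [/(collapse_fibre C) <-|_].
      by rewrite mul1n -sum1dep_card.
    by rewrite mul0n.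
  rewrite (partition_big r fr) /=; last first.
    move=> u; rewrite /r /fr; case ou: (o u) => [v|] //= _.
    by have [_ _ _ /eqP] := collapse_owned C ou.
  apply: eq_bigr => v _; apply: eq_bigl => u; rewrite /r; case: (o u) => //= w.
rewrite -!big_split /=; apply: eq_bigr => u _; rewrite /fr.
case ou: (o u) => [v|] /=.
  by have [/eqP -> -> _ _ _] := collapse_owned C ou.
case: (collapse_free C ou) => [[-> /eqP ->]|[-> ne]]; rewrite ?eqxx /= ?wk ?mul1n; first by lia.
by case: eqP.
Qed.

(** Paths of [g] are carried to [g'] by sending vertices to their representatives. Conversely paths
    of [g'] are paths of [g], and every absorbed vertex is adjacent to its owner. *)
Lemma good_collapse : wt k = m.+2 -> good g = good g'.
Proof.
move=> wk; have [irr sym] := simpleP _ sg; have [_ sym'] := simpleP _ simple_collapse.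
apply/goodP/goodP => -[_ pres conn wgt]; split; rewrite ?simple_collapse //.
- move=> u w; rewrite (collapse_restr C) => /and3P [/eqP ou _ /pres].
  by have := @present_repr u; rewrite /r ou.
- move=> u v pu pv.
  have /(connect_homo (r := r) (e' := adj g'.1)) := conn _ _ (present_collapse pu) (present_collapse pv).
  rewrite /r (present_free pu) (present_free pv) /=; apply=> x y /collapse_adj_repr.
  by rewrite /r => -[->|/connect1].
- by rewrite -weight_collapse.
- move=> u w auw; case ou: (o u) => [v|].
    by have [/eqP -> ] := collapse_owned C ou.
  have /collapse_adj_repr := auw; rewrite /r ou /=; case ow: (o w) => [z|] /= H.
    case: H => [uz|/pres /present_collapse //].
    by have [_ _ /eqP] := collapse_owned C ow; rewrite uz => ->.
  case: H => [uz|/pres /present_collapse //]; by rewrite uz irr in auw.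
- move=> u v pu pv.
  apply: connect_trans (adj_repr u) _; rewrite (sym_connect_sym sym).
  apply: connect_trans (adj_repr v) _.
  have := conn _ _ (present_repr pv) (present_repr pu); apply: connect_sub => x y.
  by rewrite (collapse_restr C) => /and3P [_ _ /connect1].
- by rewrite weight_collapse.
Qed.

(** For twins, each removed vertex has a twin that is kept, so its removal cannot make two closed
    neighborhoods equal. For leaves, [u] owns nothing, hence loses no neighbor. *)
Lemma link_collapse u v : plain g' u -> plain g' v -> link tw g' u v = link tw g u v.
Proof.
move=> pu pv; have [ou _ nu] := plain_kept pu; have [ov _ nv] := plain_kept pv.
have [irr sym] := simpleP _ sg; rewrite /link; case twE: tw.
  congr (_ && _).
  have rE x y : o x = None -> (r y \in cnbhd g'.1 x) = (y \in cnbhd g.1 x).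
    move=> ox; rewrite [RHS]cnbhd_sym // -[cnbhd g.1 y]twin_repr ?twE // [RHS]cnbhd_sym // !in_cnbhd.
    by rewrite (collapse_restr C) ox repr_free.
  apply/eqP/eqP => /setP E; apply/setP => w; first by rewrite -!rE.
  have rK x y : o x = None -> (y \in cnbhd g'.1 x) = (o y == None) && (y \in cnbhd g.1 x).
    move=> ox; rewrite !in_cnbhd (collapse_restr C) ox /=.
    by case: eqVneq => [->|_] //=; rewrite ox.
  by rewrite !rK // E.
have -> // : nbhd g'.1 u = nbhd g.1 u.
apply/setP => w; rewrite !in_nbhd (collapse_restr C) ou /=.
case ow: (o w) => [z|] //=; apply/esym/negP; rewrite sym => wu.
have [_ _ _ _] := collapse_owned C ow; rewrite /link twE => /eqP /setP /(_ u).
rewrite in_nbhd wu inE => /esym /eqP uz; by case: (nu w); rewrite uz.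
Qed.

Lemma used_collapse : k \notin used g ->
  used g' = used g \/ used g' = k |: used g.
Proof.
move=> ku.
have other c : c != k -> (c \in used g') = (c \in used g).
  move=> ck; rewrite !inE; apply/existsP/existsP => -[u /eqP uc]; exists u.
    have ou : o u = None by apply: present_free; rewrite uc.
    case: (collapse_free C ou) => [[ucc _]|[<- _]]; last by rewrite uc.
    by move: ucc; rewrite uc => -[E]; rewrite E eqxx in ck.
  case ou: (o u) => [v|]; first by have [/eqP] := collapse_owned C ou; rewrite uc.
  by case: (collapse_free C ou) => [[_ /eqP]|[-> _]]; rewrite uc.
case kg': (k \in used g'); [right|left]; apply/setP => c; rewrite ?in_setU1.
  by have [->|/other //] := eqVneq c k; rewrite kg'.
by have [->|/other //] := eqVneq c k; rewrite kg' (negPf ku).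
Qed.

Lemma used_collapse_inv (S : {set K}) : k \notin S ->
  used g' = S \/ used g' = k |: S -> used g = S.
Proof.
move=> kS H.
have kg : k \notin used g.
  rewrite inE; apply/existsP => -[u /eqP uk].
  case ou: (o u) => [v|]; first by have [/eqP] := collapse_owned C ou; rewrite uk.
  by case: (collapse_free C ou) => [[_ /eqP]|[_]]; rewrite uk.
have E (X : {set K}) : k \notin X -> X = (k |: X) :\ k.
  move=> kX; apply/setP => c; rewrite !inE; case: eqVneq => [->|] //=; exact/negbTE.
have A : (used g') :\ k = used g.
  case: (used_collapse kg) => ->; last by rewrite -E.
  by apply/setP => c; rewrite in_setD1; case: eqVneq => [->|] //=; exact/esym/negbTE.
rewrite -A; case: H => ->; last by rewrite -E.
by apply/setP => c; rewrite in_setD1; case: eqVneq => [->|] //=; exact/esym/negbTE.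
Qed.

End Collapse.
End ColouredGraphs.

(** * Existence of collapses, existence and uniqueness of expansions *)

Lemma subset_of_card (T : finType) (X : {set T}) s : s <= #|X| ->
  exists2 U : {set T}, U \subset X & #|U| = s.
Proof.
move=> sX; exists [set u in take s (enum X)].
  by apply/subsetP => u; rewrite inE => /mem_take; rewrite mem_enum.
rewrite cardsE (card_uniqP _) ?take_uniq ?enum_uniq // size_takel //.
by rewrite -cardE.
Qed.

Lemma fibred_choice (T : finType) s (D U : {set T}) : s * #|D| <= #|U| ->
  exists o : T -> option T, [/\ forall u v, o u = Some v -> u \in U /\ v \in D
    & forall v, v \in D -> #|[set u | o u == Some v]| = s].
Proof.
elim: {D}#|D| {-2}D (erefl #|D|) U => [|d IH] D cD U.
  move=> _; exists (fun=> None); split=> // v.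
  by move/eqP: cD; rewrite cards_eq0 => /eqP ->; rewrite inE.
have /card_gt0P [v vD] : 0 < #|D| by rewrite cD.
rewrite (cardsD1 v) vD mulnDr muln1 => sU.
have [W WU cW] : exists2 W : {set T}, W \subset U & #|W| = s by apply: subset_of_card; lia.
have cD' : #|D :\ v| = d by move: cD; rewrite (cardsD1 v) vD => -[].
have [|o [oin ofib]] := IH _ cD' (U :\: W).
  by rewrite (cardsD U) (setIidPr WU) cW; lia.
exists (fun u => if u \in W then Some v else o u); split=> [u x|x xD].
  case: ifP => [uW [<-]|_ /oin]; first by rewrite (subsetP WU).
  by rewrite !inE => -[/andP[_ ->] /andP[_ ->]].
have [->|xv] := eqVneq x v.
  rewrite -[RHS]cW; apply: eq_card => u; rewrite inE; case: ifP => [_|_]; first exact: eqxx.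
  by apply/eqP => /oin; rewrite !inE eqxx => -[].
rewrite -(ofib x) ?inE ?xv //; apply: eq_card => u; rewrite !inE.
case: ifP => // uW; rewrite (inj_eq Some_inj) eq_sym (negPf xv).
by apply/esym/eqP => /oin; rewrite inE uW => -[].
Qed.

Section CollapseExistence.
Variables (n : nat) (K : finType) (wt : K -> nat).
Implicit Types (g h : cgraph n K) (tw : bool) (u v w : 'I_n).

(** A condition on [o] alone, boolean and over a finite type, so that an [o] absorbing as many
    vertices as possible can be chosen. *)
Definition collapsible tw m g (o : {ffun 'I_n -> option 'I_n}) :=
  [forall u, forall v, (o u == Some v) ==>
    [&& plain g u, plain g v, o v == None, link tw g u v
      & #|[set w | o w == Some v]| == m.+1]].

Lemma collapsibleP tw m g (o : {ffun 'I_n -> option 'I_n}) :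
  reflect (forall u v, o u = Some v ->
    [/\ plain g u, plain g v, o v = None, link tw g u v
      & #|[set w | o w == Some v]| = m.+1]) (collapsible tw m g o).
Proof.
apply: (iffP forallP) => H u => [v ouv|].
  by have /implyP := forallP (H u) v; rewrite ouv eqxx => /(_ isT) /and5P [-> -> /eqP -> -> /eqP ->].
apply/forallP => v; apply/implyP => /eqP /H [-> -> -> -> ->].
by rewrite !eqxx.
Qed.

Definition collapsed (k : K) g (o : {ffun 'I_n -> option 'I_n}) : cgraph n K :=
  ([set e | [&& o e.1 == None, o e.2 == None & adj g.1 e.1 e.2]],
   [ffun u => if o u != None then None
              else if [exists w, o w == Some u] then Some (Some k) else g.2 u]).

Lemma collapsedP tw m k g o : k \notin used g -> collapsible tw m g o ->
  collapse tw m k g (collapsed k g o) o.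
Proof.
move=> ku /collapsibleP H; split=> [u v ouv|u ou|u w|v].
- have [pu pv ov luv _] := H u v ouv; rewrite !ffunE ouv ov /=; split=> //.
  by case: existsP => // -[]; exists u; rewrite ouv.
- rewrite ffunE ou /=; case: existsP => [[w /eqP /H [_ pu _ _ _]]|_]; [by left|right].
  split=> // uk; case/negP: ku; rewrite inE; apply/existsP; exists u; exact/eqP.
- by rewrite {1}/adj inE.
- rewrite ffunE; case: (o v) => //=; case: existsP => [[w /eqP /H [] //]|_ vk].
  by case/negP: ku; rewrite inE; apply/existsP; exists v; exact/eqP.
Qed.

(* A collapse with as many removed vertices as possible leaves no vertex to which [m.+1] others are linked. *)
Lemma collapse_exists tw m k g : simple_graph g.1 -> k \notin used g ->
  exists g' o, collapse tw m k g g' o /\ lim tw m g'.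
Proof.
move=> sg ku.
have v0 : collapsible tw m g [ffun=> None] by apply/collapsibleP => u v; rewrite ffunE.
case: (@arg_maxnP _ _ (collapsible tw m g) (fun o : {ffun 'I_n -> option 'I_n} => #|[set u | o u != None]|) v0) => o vo max.
have C := collapsedP ku vo; exists (collapsed k g o), o; split=> //.
set g' := collapsed k g o in C *.
apply/forallP => v; apply/implyP => pv; rewrite leqNgt; apply/negP => mv.
have [U /subsetP UX cU] := subset_of_card mv.
have HU u : u \in U -> [/\ plain g u, o u = None, forall w, o w <> Some u & link tw g u v].
  move=> /UX; rewrite inE => /andP [pu].
  rewrite (link_collapse sg C pu pv) => luv.
  by have [ou pu' nu] := plain_kept C pu.
have [ov pgv nv] := plain_kept C pv.
(* Letting [v] absorb the [m.+1] vertices of [U] as well contradicts the maximality of [o]. *)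
pose o2 := [ffun u => if u \in U then Some v else o u].
have vU : v \notin U by apply/negP => /HU [_ _ _]; rewrite link_irr.
have : collapsible tw m g o2.
  apply/collapsibleP => u w; rewrite ffunE; case: ifP => [uU [<-]|uU ouw].
    have [pu ou nu luv] := HU u uU; rewrite ffunE (negPf vU) ov; split=> //.
    rewrite -[RHS]cU; apply: eq_card => x; rewrite inE ffunE; case: ifP => [_|_]; first exact: eqxx.
    exact/eqP/nv.
  have [pu pw ow luw cw] := collapsibleP _ _ _ _ vo u w ouw.
  rewrite ffunE ow; case: ifP => [/HU [_ _ /(_ u)] //|_]; split=> //.
  rewrite -[RHS]cw; apply: eq_card => x; rewrite !inE ffunE; case: ifP => // xU.
  have [_ -> _ _] := HU x xU; apply/eqP => -[vw]; by case: (nv u); rewrite vw.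
move=> /max /=; rewrite /geq /= leqNgt => /negP; apply.
apply: proper_card; apply/properP; split.
  by apply/subsetP => x; rewrite !inE ffunE; case: ifP.
have /card_gt0P [x xU] : 0 < #|U| by rewrite cU.
by exists x; rewrite !inE ?ffunE ?xU //; have [_ -> _ _] := HU x xU.
Qed.

Hypothesis wt_gt0 : forall k, 0 < wt k.

Definition expanded tw (k : K) g' (o : 'I_n -> option 'I_n) : cgraph n K :=
  ([set e | expand_adj tw g' o e.1 e.2],
   [ffun u => if o u != None then Some None
              else if g'.2 u == Some (Some k) then Some None else g'.2 u]).

Lemma expand_exists tw m k g' : good wt g' -> wt k = m.+2 ->
  exists g o, simple_graph g.1 /\ collapse tw m k g g' o.
Proof.
case/goodP => sg' pres _ wgt wk; have [irr sym] := simpleP _ sg'.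
pose D := [set v | g'.2 v == Some (Some k)]; pose U := [set u | g'.2 u == None].
have [|o [oin ofib]] := @fibred_choice _ m.+1 D U.
  have : n = \sum_(u < n) 1 by rewrite sum1_card card_ord.
  rewrite -{1}wgt => E.
  have : #|D| * m.+1 + \sum_(u : 'I_n) 1 <= \sum_u colour_weight wt (g'.2 u) + #|U|.
    rewrite -!sum1_card !(big_mkcond (fun u => u \in _)) /= big_distrl -!big_split /=.
    apply: leq_sum => u _; rewrite !inE; case: (g'.2 u) => [[c|]|] //=.
    case: eqVneq => [[->]|_]; rewrite ?wk; first by lia.
    by have := wt_gt0 c; lia.
  by rewrite E; lia.
exists (expanded tw k g' o), o.
have om u v : o u = Some v -> [/\ g'.2 u = None, g'.2 v = Some (Some k) & o v = None].
  move=> ouv; have [] := oin _ _ ouv; rewrite !inE => /eqP uN /eqP vk; split=> //.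
  by case ov: (o v) => [z|//]; have [] := oin _ _ ov; rewrite inE vk.
have sg : simple_graph (expanded tw k g' o).1.
  apply/simpleP; split=> [u|u w]; rewrite /adj !inE /expand_adj; case: tw; rewrite ?eqxx //=.
  - rewrite orbA orbb irr orbF; apply/eqP => ouu.
    by have [-> ] := om _ _ ouu.
  - by rewrite eq_sym; congr (_ && _); rewrite eq_sym sym.
  - by rewrite sym orbCA.
have aE u w : adj (expanded tw k g' o).1 u w = expand_adj tw g' o u w by rewrite {1}/adj inE.
split=> //; split.
- move=> u v ouv; have [uN vk ov] := om _ _ ouv.
  rewrite /plain !ffunE ouv ov vk !eqxx /=; split=> //.
  rewrite /link; case twE: tw in aE *.
    have uv : u != v by apply/eqP => E; rewrite E ov in ouv.
    rewrite uv /=; apply/eqP/setP => w; rewrite !in_cnbhd !aE /expand_adj ouv ov /=.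
    case: (eqVneq w u) => [->|wu] /=; first by rewrite ouv /= [v == u]eq_sym (negPf uv) /= eqxx.
    by case: (eqVneq w v) => [->|wv] /=; rewrite ?uv ?ov ?eqxx.
  apply/eqP/setP => w; rewrite in_nbhd aE /expand_adj ouv in_set1.
  have -> : (o w == Some u) = false by apply/eqP => /om []; rewrite uN.
  have -> : adj g'.1 u w = false by apply/negP => /pres; rewrite uN.
  by rewrite !orbF; apply/eqP/eqP => [[->]|->].
- move=> u ou; rewrite /plain !ffunE ou /=.
  by case: (g'.2 u =P Some (Some k)) => [->|ne]; [left; rewrite eqxx|right].
- move=> u w; rewrite aE /expand_adj.
  case ou: (o u) => [v|] /=; first by apply/negP => /pres; have [->] := om _ _ ou.
  case ow: (o w) => [v|] /=; first by apply/negP; rewrite sym => /pres; have [->] := om _ _ ow.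
  case: (tw) => //; case: eqVneq => [->|] //=; by rewrite irr.
- by move=> v vk; apply: ofib; rewrite inE vk.
Qed.

Lemma ciso_expand tw m k g g' o h h' o2 :
  simple_graph g.1 -> simple_graph h.1 -> good wt g' -> good wt h' ->
  collapse tw m k g g' o -> collapse tw m k h h' o2 -> ciso g' h' -> ciso g h.
Proof.
move=> sg sh /goodP [sg' presg _ _] /goodP [sh' presh _ _] Cg Ch /cisoP [p [pc pa]].
pose lab x (F : 'I_n -> option 'I_n) (c : cgraph n K) u : option 'I_n * option 'I_n :=
  if F u is Some v then (Some (x v), None)
  else (None, if c.2 u == None then None else Some (x u)).
have freeg := present_free Cg; have freeh := present_free Ch.
have [q Hq] : exists q : {perm 'I_n}, forall u, lab id o2 h' (q u) = lab p o g' u.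
  apply: (@eq_fibre_perm_but _ _ (None, None)) => -[[z|] [y|]] // _.
  - by rewrite !eq_card0 // => u; rewrite !inE /lab; case: (o u) (o2 u) => [?|] [?|]; rewrite xpair_eqE ?andbF.
  - have lE (x : {perm 'I_n}) (F : 'I_n -> option 'I_n) (c : cgraph n K) :
        [set u | lab x F c u == (Some z, None)] = [set u | F u == Some (x^-1 z)%g].
      apply/setP => u; rewrite !inE /lab; case: (F u) => [v|] //.
      by apply/eqP/eqP => [[<-]|[->]]; rewrite ?permK ?permKV.
    have := lE 1%g o2 h'; rewrite invg1 perm1.
    have -> : [set u | lab (1%g : {perm 'I_n}) o2 h' u == (Some z, None)] = [set u | lab id o2 h' u == (Some z, None)].
      by apply/setP => u; rewrite !inE /lab; case: (o2 u) => [v|]; rewrite perm1.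
    rewrite lE => ->.
    have cz : g'.2 (p^-1 z)%g = h'.2 z by rewrite pc permKV.
    case zk: (h'.2 z == Some (Some k)).
      rewrite (collapse_fibre Cg) ?cz; last exact/eqP.
      by rewrite (collapse_fibre Ch) //; exact/eqP.
    rewrite !eq_card0 // => u; rewrite !inE; apply/eqP => /collapse_owned.
      by case/(_ _ _ _ _ _ _ Ch) => _ _ _ H _; rewrite H eqxx in zk.
    by case/(_ _ _ _ _ _ _ Cg) => _ _ _ H _; rewrite cz in H; rewrite H eqxx in zk.
  - have -> : [set u | lab p o g' u == (None, Some y)] = [set u | (u == p^-1 y)%g && (h'.2 y != None)].
      apply/setP => u; rewrite !inE /lab -(inj_eq (@perm_inj _ p)) permKV.
      case: (eqVneq (p u) y) => [<-|ne] /=.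
        rewrite -pc; case gu: (g'.2 u) => [c|]; last by case: (o u).
        by rewrite freeg ?gu //= eqxx.
      by case: (o u) => [v|] //; case: ifP => // _; apply/eqP => -[] /eqP; rewrite (negPf ne).
    have -> : [set u | lab id o2 h' u == (None, Some y)] = [set u | (u == y) && (h'.2 y != None)].
      apply/setP => u; rewrite !inE /lab.
      case: (eqVneq u y) => [<-|ne] /=.
        case hu: (h'.2 u) => [c|]; last by case: (o2 u).
        by rewrite freeh ?hu //= eqxx.
      by case: (o2 u) => [v|] //; case: ifP => // _; apply/eqP => -[] /eqP; rewrite (negPf ne).
    case: (h'.2 y != None).
      have E x : [set u : 'I_n | (u == x) && true] = [set x] by apply/setP => u; rewrite !inE andbT.
      by rewrite !E !cards1.
    have E x : [set u : 'I_n | (u == x) && false] = set0 by apply/setP => u; rewrite !inE andbF.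
    by rewrite !E.
have qpres u : g'.2 u <> None -> q u = p u /\ o2 (q u) = None.
  move=> /[dup] /freeg ou /eqP pu; have := Hq u; rewrite /lab ou (negPf pu).
  by case: (o2 (q u)) => // -[]; case: ifP => // _ [].
have qo u : o2 (q u) = omap q (o u).
  case ou: (o u) => [v|] /=; have := Hq u; rewrite /lab ou; case: (o2 (q u)) => [w|] //= [->].
  by have [_ _ _ H _] := collapse_owned Cg ou; have [|-> //] := qpres v; rewrite H.
have qc u : g'.2 u = h'.2 (q u).
  case gu: (g'.2 u) => [c|]; first by have [|-> _] := qpres u; rewrite -?pc gu.
  case ou: (o u) => [v|].
    have := qo u; rewrite ou /= => E; by have [_ ->] := collapse_owned Ch E.
  have := Hq u; rewrite /lab ou gu eqxx qo ou /=.
  by case: ifP => [/eqP ->|].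
have qa u w : adj g'.1 u w = adj h'.1 (q u) (q w).
  have [_ symg] := simpleP _ sg'; have [_ symh] := simpleP _ sh'.
  case gu: (g'.2 u) => [c|]; last first.
    apply/idP/idP => [/presg //|/presh]; by rewrite -qc.
  case gw: (g'.2 w) => [d|]; last first.
    by rewrite symg symh; apply/idP/idP => [/presg //|/presh]; rewrite -qc.
  have [-> _] : q u = p u /\ o2 (q u) = None by apply: qpres; rewrite gu.
  have [-> _] : q w = p w /\ o2 (q w) = None by apply: qpres; rewrite gw.
  exact: pa.
apply/cisoP; exists q; split=> [u|u w].
  case ou: (o u) => [v|].
    have E := qo u; rewrite ou /= in E.
    by have [/eqP -> _ _ _ _] := collapse_owned Cg ou; have [/eqP -> _ _ _ _] := collapse_owned Ch E.
  have E := qo u; rewrite ou /= in E.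
  case: (collapse_free Cg ou) (collapse_free Ch E) => [[a /eqP ->]|[a na]] [[b /eqP ->]|[b nb]] //.
  - by rewrite -qc a in b; rewrite -b in nb.
  - by rewrite -qc a in b; rewrite b in na.
  - by rewrite -a -b qc.
rewrite (collapse_adjE sg Cg) (collapse_adjE sh Ch) /expand_adj.
have rq x : odflt (q x) (o2 (q x)) = q (odflt x (o x)) by rewrite qo; case: (o x).
have so x y : (o2 (q x) == Some (q y)) = (o x == Some y).
  by rewrite qo; case: (o x) => [v|] //=; apply/eqP/eqP => [[/perm_inj ->]|[->]].
by rewrite !rq !so !qa !(inj_eq (@perm_inj _ q)).
Qed.
End CollapseExistence.

(** * Uniqueness of the collapse up to isomorphism *)

Lemma card_set_sum (T : finType) (P : pred T) : #|[set x | P x]| = \sum_x (P x : nat).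
Proof. by rewrite -sum1dep_card big_mkcond; apply: eq_bigr => x _; case: (P x). Qed.

Section CollapseUniqueness.
Variables (n : nat) (K : finType) (wt : K -> nat).
Implicit Types (g h : cgraph n K) (tw : bool) (u v w : 'I_n) (Y : {set 'I_n}).

(** The set on which [link] depends: closed twins share a closed neighborhood, and the leaves at [v]
    are the vertices with neighborhood [[set v]]. *)
Definition nb tw (G : graph n) v := if tw then cnbhd G v else nbhd G v.

Lemma nb_sym tw (G : graph n) u v : simple_graph G -> (u \in nb tw G v) = (v \in nb tw G u).
Proof.
move=> sG; case: tw; rewrite /nb; first exact: cnbhd_sym.
by rewrite !in_nbhd; have [_ ->] := simpleP _ sG.
Qed.

Lemma adj_nb tw (G : graph n) u v : simple_graph G -> adj G u v = (v \in nb tw G u) && (u != v).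
Proof.
move=> sG; have [irr _] := simpleP _ sG; rewrite eq_sym.
case: tw; rewrite /nb ?in_cnbhd ?in_nbhd; case: eqVneq => [->|] /=; rewrite ?irr ?andbT ?andbF //.
Qed.

(** The centres of more than [m] uncoloured leaves, defined without reference to a collapse; by
    [leaf_fresh] they are the vertices that a leaf collapse recolours. *)
Definition heavy m g v :=
  plain g v && (m < #|[set u | plain g u & link false g u v]|).

(* Where [2 < n] enters: in [K_2] a leaf is also a twin and a tuft centre. *)
Lemma no_isolated_edge g u v : 2 < n -> good wt g -> plain g u -> plain g v ->
  (forall w, adj g.1 u w -> w = v) -> (forall w, adj g.1 v w -> w = u) -> False.
Proof.
move=> n2 /goodP [sg _ conn wgt] pu pv uv vu; have [_ sym] := simpleP _ sg.
have cl : closed (adj g.1) [set u; v].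
  apply: intro_closed; first exact: sym_connect_sym.
  by move=> x y xy /set2P xE; case: xE xy => ->; [move/uv|move/vu] => ->; rewrite !inE eqxx ?orbT.
(* By connectedness no vertex lies outside [[set u; v]], so the total weight [n] would be at most
   2. *)
move: n2; rewrite ltnNge => /negP; apply; rewrite -{1}wgt.
have c2 : #|[set u; v]| <= 2 by rewrite cards2; case: (_ != _).
apply: leq_trans c2; rewrite -sum1_card [leqRHS]big_mkcond /=.
apply: leq_sum => w _; case: ifP => [|wN].
  by case/set2P => ->; rewrite ?(eqP pu) ?(eqP pv).
case wc: (g.2 w) => [c|] //; exfalso.
have : connect (adj g.1) u w by apply: conn; rewrite ?wc // (eqP pu).
by move=> /(closed_connect cl); rewrite wN !inE eqxx.
Qed.

(** A collapse is not unique, but the number of vertices of a given neighborhood and colour that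
    receive a given new colour is. These numbers yield the isomorphism in [ciso_collapse]. *)
Definition colour_count tw g Y (c : option (option K)) := #|[set u | (nb tw g.1 u == Y) && (g.2 u == c)]|.
Definition status_count tw g g' Y (c c' : option (option K)) :=
  #|[set u | [&& nb tw g.1 u == Y, g.2 u == c & g'.2 u == c']]|.

Section OneCollapse.
Variables (tw : bool) (m : nat) (k : K) (g g' : cgraph n K) (o : 'I_n -> option 'I_n).
Hypotheses (gg : good wt g) (C : collapse tw m k g g' o).

Let sg : simple_graph g.1. Proof. by case/goodP: gg. Qed.

Lemma collapse_status u : g.2 u = Some None ->
  [|| g'.2 u == Some (Some k), g'.2 u == None | g'.2 u == Some None].
Proof.
move=> pu; case ou: (o u) => [v|]; first by have [_ -> _ _ _] := collapse_owned C ou; rewrite orbT.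
by case: (collapse_free C ou) => [[-> _]|[-> _]]; rewrite ?pu ?eqxx ?orbT.
Qed.

Lemma collapse_status_other u : g.2 u <> Some None -> g'.2 u = g.2 u.
Proof.
move=> pu; case ou: (o u) => [v|]; first by have [/eqP] := collapse_owned C ou.
by case: (collapse_free C ou) => [[_ /eqP]|[]].
Qed.

(** Only uncoloured vertices change, and they are recoloured, absorbed or kept. All counts therefore
    follow from [g] and the numbers of recoloured and absorbed vertices. *)
Lemma status_countE Y (c c' : option (option K)) : status_count tw g g' Y c c' =
  if c == Some None then
    if c' == Some (Some k) then status_count tw g g' Y (Some None) (Some (Some k))
    else if c' == None then status_count tw g g' Y (Some None) None
    else if c' == Some None then
      colour_count tw g Y (Some None)
      - status_count tw g g' Y (Some None) (Some (Some k))
      - status_count tw g g' Y (Some None) None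
    else 0
  else if c' == c then colour_count tw g Y c else 0.
Proof.
case: eqVneq => [->|/eqP cx]; last first.
  case: eqVneq => [->|/eqP cc']; [apply: eq_card|apply: eq_card0] => u; rewrite !inE.
    by case: (_ == Y) => //=; case: (g.2 u =P c) => //= uc; rewrite collapse_status_other uc ?eqxx.
  apply/negP => /and3P [_ /eqP uc /eqP uc']; apply: cc'; rewrite -uc -uc' collapse_status_other //.
  by rewrite uc.
case: eqVneq => [-> //|c'k]; case: eqVneq => [-> //|c'0]; case: eqVneq => [->|c'x]; last first.
  apply: eq_card0 => u; rewrite !inE; apply/negP => /and3P [_ /eqP /collapse_status + /eqP uc].
  by rewrite uc (negPf c'k) (negPf c'0) (negPf c'x).
suff -> : colour_count tw g Y (Some None) = status_count tw g g' Y (Some None) (Some (Some k))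
   + status_count tw g g' Y (Some None) None + status_count tw g g' Y (Some None) (Some None)
  by rewrite -addnA !addKn.
rewrite /colour_count /status_count !card_set_sum -!big_split /=.
apply: eq_bigr => u _; case: (_ == Y) => //=; case: (g.2 u =P Some None) => //= /collapse_status.
by case/or3P => /eqP ->; rewrite ?eqxx.
Qed.

Lemma removed_status u : (g.2 u == Some None) && (g'.2 u == None) = (o u != None).
Proof.
case ou: (o u) => [v|] /=; first by have [/eqP -> -> _ _ _] := collapse_owned C ou.
by case: (collapse_free C ou) => [[-> _]|[-> _]]; rewrite ?andbF //; case: (g.2 u) => [?|]; rewrite ?andbF.
Qed.

Lemma fresh_plain u : g'.2 u = Some (Some k) -> plain g u.
Proof.
move=> uk; have ou : o u = None by apply: (present_free C); rewrite uk.
by case: (collapse_free C ou) => [[]//|[<-]]; rewrite uk.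
Qed.

(** Here [o] has disappeared, so a permutation that respects [g] and the colours of [g'] also
    respects the adjacency of [g']. *)
Lemma restrict_adjE u w :
  adj g'.1 u w = [&& g'.2 u != None, g'.2 w != None & adj g.1 u w].
Proof.
rewrite (collapse_restr C); case a: (adj g.1 u w); rewrite ?andbF // !andbT.
have [_ pres _ _] := goodP _ _ gg; have [_ sym] := simpleP _ sg.
have E x : g.2 x <> None -> (o x == None) = (g'.2 x != None).
  move=> px; case ox: (o x) => [z|] /=; first by have [_ ->] := collapse_owned C ox.
  by case: (collapse_free C ox) => [[->]|[-> _]] //; apply/esym/eqP.
by rewrite !E //; [apply: pres; rewrite sym; exact: a | apply: pres; exact: a].
Qed.

Hypothesis lg' : lim tw m g'.

(* In a class of closed twins of size [q * m.+2 + r] with [r < m.+2] exactly [q] groups are collapsed. *)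
Lemma twin_status Y : tw ->
  status_count tw g g' Y (Some None) (Some (Some k)) = colour_count tw g Y (Some None) %/ m.+2
  /\ status_count tw g g' Y (Some None) None = (colour_count tw g Y (Some None) %/ m.+2) * m.+1.
Proof.
move=> tw1.
set f := status_count _ _ _ _ _ (Some (Some k)); set r := status_count _ _ _ _ _ None.
have rf : r = f * m.+1.
  pose D := [set v | [&& nb tw g.1 v == Y, g.2 v == Some None & g'.2 v == Some (Some k)]].
  pose rp u := odflt u (o u).
  have nbr u : nb tw g.1 (rp u) = nb tw g.1 u by rewrite /nb tw1 (twin_repr C).
  rewrite /r /status_count -sum1dep_card (partition_big rp (mem D)) /=; last first.
    move=> u /and3P [nu pu ru]; have := removed_status u; rewrite pu ru.
    rewrite !inE nbr nu /rp; case ou: (o u) => [v|] // _ /=.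
    by have [_ _ /eqP -> -> _] := collapse_owned C ou; rewrite !eqxx.
  rewrite /f /status_count -/D -sum1_card big_distrl /=; apply: eq_bigr => v.
  rewrite inE mul1n => /and3P [nv pv /eqP fv]; rewrite -(collapse_fibre C fv) -sum1dep_card.
  apply: eq_bigl => u; rewrite removed_status -nbr /rp.
  case ou: (o u) => [w|]; last by rewrite andbF.
  by rewrite /= andbT; case: (eqVneq w v) => [->|wv]; rewrite ?nv ?andbF ?eqxx //; apply/esym/eqP => -[] /eqP; rewrite (negPf wv).
have := status_countE Y (Some None) (Some None); rewrite -/f -/r /= => kept.
have tot : f + r <= colour_count tw g Y (Some None).
  rewrite /f /r /colour_count /status_count !card_set_sum -!big_split /=.
  apply: leq_sum => u _; case: (_ == Y) => //=; case: (g.2 u =P Some None) => //= _.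
  by case: (g'.2 u) => [[c|]|] //; case: (_ == _).
(* A kept vertex has at most [m] kept twins, so at most [m.+1] vertices of the class are kept: a
   remainder modulo [m.+2]. *)
have kle : status_count tw g g' Y (Some None) (Some None) <= m.+1.
  rewrite /status_count; set A := [set _ | _].
  have [->|[v vA]] := set_0Vmem A; first by rewrite cards0.
  have := vA; rewrite inE => /and3P [/eqP nv _ pv].
  have /implyP /(_ pv) := forallP lg' v.
  rewrite (cardsD1 v A) vA add1n ltnS; apply: leq_trans.
  apply/subset_leq_card/subsetP => u; rewrite !inE => /andP [uv /and3P [/eqP nu _ pu]].
  rewrite (link_collapse sg C) // /plain pu /link tw1 uv /=.
  by move: nu nv; rewrite /nb tw1 => -> ->.
have : f = colour_count tw g Y (Some None) %/ m.+2; last by move=> <-.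
rewrite (_ : colour_count _ _ _ _ = f * m.+2 + status_count tw g g' Y (Some None) (Some None)).
  by rewrite divnMDl // divn_small // addn0.
by lia.
Qed.

Hypothesis n_gt2 : 2 < n.

(** Suppose a heavy [v] is not recoloured. If [v] is absorbed, it is itself a leaf and forms an
    isolated edge with its leaf. Otherwise all its uncoloured leaves stay uncoloured, since they
    could only be absorbed by [v] or own [v], and this violates [lg']. *)
Lemma leaf_fresh v : ~~ tw -> (g'.2 v == Some (Some k)) = heavy m g v.
Proof.
move=> tw0; have [irr sym] := simpleP _ sg.
have leafE u z : link tw g u z -> forall w, adj g.1 u w = (w == z).
  by rewrite /link (negPf tw0) => /eqP /setP E w; have := E w; rewrite in_nbhd inE.
apply/idP/andP => [/eqP vk|[pv]].
  split; first exact: fresh_plain.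
  rewrite -(collapse_fibre C vk); apply/subset_leq_card/subsetP => u; rewrite !inE => /eqP ou.
  by have [-> _ _ _] := collapse_owned C ou; rewrite (negPf tw0).
rewrite ltnNge => hv; apply/negPn/negP => vk; case/negP: hv.
case ov: (o v) => [z|].
  have [_ _ pz _ lv] := collapse_owned C ov.
  rewrite (_ : [set _ | _] = set0) ?cards0 //; apply/setP => u; rewrite !inE.
  apply/negP => /andP [pu lu].
  have luv : link tw g u v by rewrite (negPf tw0).
  have uz : u = z by apply/eqP; rewrite -(leafE _ _ lv) sym (link_adj sg luv).
  apply: (no_isolated_edge n_gt2 gg pv pz) => w.
    by rewrite (leafE _ _ lv) => /eqP.
  by rewrite -uz (leafE _ _ luv) => /eqP.
case: (collapse_free C ov) => [[/eqP]|[vE _]]; first by rewrite (negPf vk).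
have pv' : plain g' v by rewrite /plain vE.
have /implyP /(_ pv') := forallP lg' v; apply: leq_trans.
apply/subset_leq_card/subsetP => u; rewrite !inE => /andP [pu lu].
have luv : link tw g u v by rewrite (negPf tw0).
suff pu' : plain g' u by rewrite pu' (link_collapse sg C).
have [/eqP ou|] := boolP (o u == None); last first.
  case ou: (o u) => [z|] // _; have [_ _ _ zk lz] := collapse_owned C ou.
  have : z == v by rewrite -(leafE _ _ luv) (link_adj sg lz).
  by move/eqP => zv; rewrite zv in zk; rewrite zk eqxx in vk.
case: (collapse_free C ou) => [[uk _]|[uE _]]; last by rewrite /plain uE.
have /card_gt0P [w] : 0 < #|[set w | o w == Some u]| by rewrite (collapse_fibre C).
rewrite inE => /eqP ow; have [_ _ _ _ lw] := collapse_owned C ow.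
have : w == v by rewrite -(leafE _ _ luv) sym (link_adj sg lw).
by move/eqP => wv; rewrite wv ov in ow.
Qed.

(** The neighborhood of an absorbed leaf is the singleton of its owner, so only the classes of such
    singletons at heavy vertices lose members, [m.+1] each. *)
Lemma leaf_status Y : ~~ tw ->
  status_count tw g g' Y (Some None) (Some (Some k)) = #|[set u | (nb tw g.1 u == Y) && heavy m g u]|
  /\ status_count tw g g' Y (Some None) None =
     if [exists v, heavy m g v && (Y == [set v])] then m.+1 else 0.
Proof.
move=> tw0; split.
  apply: eq_card => u; rewrite !inE -leaf_fresh //.
  by case: eqP => //= _; case: (g'.2 u =P _) => [/fresh_plain /eqP ->|]; rewrite ?andbF ?eqxx.
have own u v : o u = Some v -> nb tw g.1 u = [set v].
  by case/(collapse_owned C); rewrite /nb /link (negPf tw0) => _ _ _ _ /eqP.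
case: existsP => [[v /andP [hv /eqP ->]]|nex].
  rewrite -leaf_fresh // in hv; rewrite -(collapse_fibre C (eqP hv)).
  apply: eq_card => u; rewrite !inE removed_status.
  case ou: (o u) => [w|]; rewrite ?andbF // andbT (own _ _ ou).
  by apply/eqP/eqP => [/set1_inj|[]] ->.
apply: eq_card0 => u; rewrite !inE removed_status; apply/negP => /andP [/eqP nu].
case ou: (o u) => [w|] // _; case: nex; exists w; rewrite -leaf_fresh // -nu (own _ _ ou) eqxx.
by have [_ _ _ -> _] := collapse_owned C ou; rewrite eqxx.
Qed.
End OneCollapse.

Lemma card_perm_set (p : {perm 'I_n}) (P : pred 'I_n) :
  #|[set u | P (p u)]| = #|[set u | P u]|.
Proof.
rewrite -(card_imset _ (@perm_inj _ p)); apply: eq_card => u; rewrite inE.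
apply/imsetP/idP => [[x]|Pu]; first by rewrite inE => ? ->.
by exists (p^-1 u)%g; rewrite ?inE permKV.
Qed.

Lemma preimset_perm_inj (p : {perm 'I_n}) : injective (fun Y => p @^-1: Y).
Proof. by move=> X Y /setP E; apply/setP => u; have := E (p^-1 u)%g; rewrite !inE permKV. Qed.

Lemma nb_preim tw (p : {perm 'I_n}) (G H : graph n) u :
  (forall u v, adj G u v = adj H (p u) (p v)) -> nb tw G u = p @^-1: nb tw H (p u).
Proof.
move=> pa; apply/setP => w; rewrite inE.
by case: tw; rewrite /nb ?in_cnbhd ?in_nbhd pa ?(inj_eq (@perm_inj _ p)).
Qed.

(** The two collapses may absorb vertices that do not correspond under [p]. Equal status counts give
    a [q] that permutes vertices within their neighborhood classes and matches the colours before
    and after. *)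
Lemma ciso_collapse tw m k g g' o h h' o2 : 2 < n -> good wt g -> good wt h ->
  collapse tw m k g g' o -> collapse tw m k h h' o2 -> lim tw m g' -> lim tw m h' ->
  ciso g h -> ciso g' h'.
Proof.
move=> n2 gg gh Cg Ch lg lh /cisoP [p [pc pa]].
have pK := @preimset_perm_inj p.
have nbY t u Y : (nb t g.1 u == p @^-1: Y) = (nb t h.1 (p u) == Y) by rewrite (nb_preim _ _ pa) (inj_eq pK).
have p1 v : p @^-1: [set p v] = [set v].
  by apply/setP => w; rewrite !inE (inj_eq (@perm_inj _ p)).
have hE v : heavy m g v = heavy m h (p v).
  rewrite /heavy /plain pc; congr (_ && (_ < _)).
  rewrite -[RHS](card_perm_set p); apply: eq_card => u; rewrite !inE /plain pc /link; congr (_ && _).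
  by rewrite -p1; exact: (nbY false).
have cE Y c : colour_count tw g (p @^-1: Y) c = colour_count tw h Y c.
  by rewrite /colour_count -[RHS](card_perm_set p); apply: eq_card => u; rewrite !inE nbY pc.
have sE Y c c' : status_count tw g g' (p @^-1: Y) c c' = status_count tw h h' Y c c'.
  rewrite (status_countE Cg) (status_countE Ch) !cE.
  suff [-> ->] : status_count tw g g' (p @^-1: Y) (Some None) (Some (Some k)) = status_count tw h h' Y (Some None) (Some (Some k))
    /\ status_count tw g g' (p @^-1: Y) (Some None) None = status_count tw h h' Y (Some None) None by [].
  case: (orP (orbN tw)) => [tw1|tw0].
    have [-> ->] := twin_status gg Cg lg (p @^-1: Y) tw1.
    by have [-> ->] := twin_status gh Ch lh Y tw1; rewrite !cE.
  have [-> ->] := leaf_status gg Cg lg n2 (p @^-1: Y) tw0.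
  have [-> ->] := leaf_status gh Ch lh n2 Y tw0; split.
    by rewrite -[RHS](card_perm_set p); apply: eq_card => u; rewrite !inE nbY hE.
  congr (if _ then _ else _); apply/existsP/existsP => -[v /andP [hv /eqP Yv]].
    by exists (p v); rewrite -hE hv -(inj_eq pK) p1 Yv eqxx.
  by exists (p^-1 v)%g; rewrite hE permKV hv -p1 permKV Yv eqxx.
have [q Hq] : exists q : {perm 'I_n}, forall u,
    (nb tw h.1 (q u), h.2 (q u), h'.2 (q u)) = (nb tw h.1 (p u), g.2 u, g'.2 u).
  apply: (@eq_fibre_perm _ _ (fun u => (nb tw h.1 (p u), g.2 u, g'.2 u)) (fun w => (nb tw h.1 w, h.2 w, h'.2 w))) => -[[Y c] c'].
  transitivity (status_count tw g g' (p @^-1: Y) c c'); last rewrite sE.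
    by apply: eq_card => u; rewrite !inE !xpair_eqE nbY andbA.
  by apply: eq_card => u; rewrite !inE !xpair_eqE andbA.
have sh : simple_graph h.1 by case/goodP: gh.
have qa u w : adj g.1 u w = adj h.1 (q u) (q w).
  (* [q] and [p] agree up to equality of [nb], and the symmetry of [nb] allows exchanging one
     endpoint at a time. *)
  rewrite pa !(adj_nb tw _ _ sh) !(inj_eq (@perm_inj _ _)); congr (_ && _).
  have [-> _ _] := Hq u; rewrite [RHS]nb_sym //; have [-> _ _] := Hq w.
  by rewrite nb_sym.
apply/cisoP; exists q; split=> [u|u w]; first by have [] := Hq u.
rewrite (restrict_adjE gg Cg) (restrict_adjE gh Ch) -qa.
by have [_ _ ->] := Hq u; have [_ _ ->] := Hq w.
Qed.

(** Vertices that stay uncoloured keep their uncoloured twins. An absorbed or recoloured vertex has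
    no uncoloured twin: leaf and centre would have equal closed neighborhoods and form an isolated
    edge. *)
Lemma lim_twin_collapse_leaf a m k g g' o : 2 < n -> good wt g ->
  collapse false m k g g' o -> lim true a g = lim true a g'.
Proof.
move=> n2 gg C; have [sg _ _ _] := goodP _ _ gg; have [irr sym] := simpleP _ sg.
have leafE u z : o u = Some z -> forall w, adj g.1 u w = (w == z).
  move=> /(collapse_owned C) [_ _ _ _ /eqP /setP E] w.
  by have := E w; rewrite in_nbhd inE.
have nbK u : plain g' u -> nbhd g'.1 u = nbhd g.1 u.
  move=> pu; have [ou _ nu] := plain_kept C pu; apply/setP => w.
  rewrite !in_nbhd (collapse_restr C) ou /=; case ow: (o w) => [z|] //=.
  by rewrite sym (leafE _ _ ow); apply/esym/eqP => uz; case: (nu w); rewrite uz.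
have freshE u : g'.2 u = Some (Some k) -> exists w, o w = Some u.
  move=> /(collapse_fibre C) uk; have /card_gt0P [w] : 0 < #|[set w | o w == Some u]| by rewrite uk.
  by rewrite inE => /eqP; exists w.
have twE u v : cnbhd g.1 u = cnbhd g.1 v -> u != v -> forall w, o w = Some u -> w = v.
  move=> uv nuv w ow; have /setP /(_ w) := uv.
  rewrite !in_cnbhd sym [adj _ v w]sym !(leafE _ _ ow) eqxx orbT eq_sym [v == u]eq_sym (negPf nuv) orbF.
  by move=> /esym /eqP.
have caseE u : plain g u -> [\/ exists v, o u = Some v, g'.2 u = Some (Some k) | plain g' u].
  move=> pu; case ou: (o u) => [v|]; first by constructor 1; exists v.
  by case: (collapse_free C ou) => [[]|[uE _]]; [constructor 2|constructor 3; rewrite /plain uE].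
have TE v : plain g' v -> [set u | plain g u & link true g u v] = [set u | plain g' u & link true g' u v].
  move=> pv; have [ov pgv nv] := plain_kept C pv.
  apply/setP => u; rewrite !inE; apply/andP/andP => -[pu /andP [uv /eqP E]].
    have pu' : plain g' u.
      have [[z ou]|/freshE [w ow]|//] := caseE u pu.
        have : adj g.1 u v by rewrite (@adj_nb true) // uv andbT /nb E in_cnbhd eqxx.
        by rewrite (leafE _ _ ou) => /eqP vz; case: (nv u); rewrite vz.
      by have := twE _ _ E uv _ ow => wv; rewrite wv ov in ow.
    by split; rewrite // /link uv /cnbhd !nbK // -/(cnbhd _ _) E eqxx.
  by have [_ pgu _] := plain_kept C pu; split; rewrite // /link uv /cnbhd -!nbK // -/(cnbhd _ _) E eqxx.
apply/forallP/forallP => H v; apply/implyP => pv; have := H v.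
  by have [_ pgv _] := plain_kept C pv; rewrite pgv -TE.
have [pv'|npv] := boolP (plain g' v); first by rewrite /= -TE.
move=> _; rewrite (_ : [set _ | _] = set0) ?cards0 //; apply/setP => u; rewrite !inE.
apply/negP => /andP [pu /andP [uv /eqP E]].
have adjuv : adj g.1 u v by rewrite (@adj_nb true) // uv andbT /nb E in_cnbhd eqxx.
have only x y : o x = Some y -> cnbhd g.1 x = cnbhd g.1 y -> plain g y -> False.
  move=> ox xy py; have [px _ _ _ _] := collapse_owned C ox.
  apply: (no_isolated_edge n2 gg px py) => w; first by rewrite (leafE _ _ ox) => /eqP.
  move=> yw; have /setP /(_ w) := xy; rewrite !in_cnbhd yw orbT (leafE _ _ ox).
  by case/orP => /eqP // wy; rewrite wy irr in yw.
have [[z ov]|/freshE [w ow]|] := caseE v pv; last by rewrite (negPf npv).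
  have : u == z by rewrite -(leafE _ _ ov) sym.
  by move=> /eqP uz; apply: (only v z) => //; rewrite -uz.
have wu : w = u by apply: (twE v u) => //; rewrite eq_sym.
by apply: (only w v) => //; rewrite wu.
Qed.
End CollapseUniqueness.

(** * The recurrence over sets of colours *)

Section Recurrence.
Variables (n : nat) (K : finType) (wt : K -> nat).
Hypotheses (n_gt2 : 2 < n) (wt_gt0 : forall k, 0 < wt k).
Implicit Types (g h : cgraph n K) (S : {set K}) (P : pred (cgraph n K)).

Definition class_count P S :=
  nclass (@ciso n K) (fun g => good wt g && P g && (used g == S)).

Lemma used_ciso g h : ciso g h -> used g = used h.
Proof.
case/cisoP => p [pc _]; apply/setP => k; rewrite !inE.
apply/existsP/existsP => -[u uk]; first by exists (p u); rewrite -pc.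
by exists (p^-1 u)%g; rewrite pc permKV.
Qed.

(** Collapsing is a bijection on classes; each inequality is [nclass_le] for the same relation, read
    in one of its directions. The two summands record whether anything was collapsed. *)
Lemma class_count_collapse tw m k P S : wt k = m.+2 -> k \notin S ->
    (forall g g' o, good wt g -> collapse tw m k g g' o -> P g = P g') ->
  class_count P S = class_count (fun g => P g && lim tw m g) S
                  + class_count (fun g => P g && lim tw m g) (k |: S).
Proof.
move=> wk kS PC; set Q := fun g => P g && lim tw m g.
have kUS : S != k |: S by apply/eqP => E; move: kS; rewrite E setU11.
rewrite -(nclassU _ (@ciso_equiv n K)); last first.
  by move=> g h gh /eqP Sg; rewrite -(used_ciso gh) Sg.
pose R g g' := exists o, collapse tw m k g g' o.
have usedC g g' o : collapse tw m k g g' o -> (used g == S) = ((used g' == S) || (used g' == k |: S)).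
  move=> C; apply/eqP/orP => [Sg|H].
    have kg : k \notin used g by rewrite Sg.
    by case: (used_collapse C kg) => ->; rewrite Sg eqxx; [left|right].
  by apply: (used_collapse_inv C kS); case: H => /eqP; [left|right].
have sgood g : good wt g -> simple_graph g.1 by case/goodP.
apply/eqP; rewrite eqn_leq; apply/andP; split.
  apply: (nclass_le (R := R)); try exact: ciso_equiv.
    move=> g /andP [/andP [gg Pg] Sg].
    have [|g' [o [C lg']]] := @collapse_exists n K tw m k g (sgood _ gg); first by rewrite (eqP Sg).
    by exists g'; [rewrite /Q -(good_collapse (sgood _ gg) C wk) gg -(PC _ _ _ gg C) Pg lg' -(usedC _ _ _ C) Sg | exists o].
  move=> g h g' h' /andP [/andP [gg _] _] /andP [/andP [gh _] _] _ _ [o Cg] [o2 Ch].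
  have gg' : good wt g' by rewrite -(good_collapse (sgood _ gg) Cg wk).
  have gh' : good wt h' by rewrite -(good_collapse (sgood _ gh) Ch wk).
  exact: ciso_expand (sgood _ gg) (sgood _ gh) gg' gh' Cg Ch.
apply: (nclass_le (R := fun g' g => R g g')); try exact: ciso_equiv.
  move=> g' /andP [/andP [gg' /andP [Pg' _]] Sg'].
  have [g [o [sg C]]] := expand_exists wt_gt0 tw gg' wk.
  have gg : good wt g by rewrite (good_collapse sg C wk).
  by exists g; [rewrite gg (PC _ _ _ gg C) Pg' (usedC _ _ _ C) Sg' | exists o].
move=> g' h' g h /andP [/andP [_ /andP [_ lg]] _] /andP [/andP [_ /andP [_ lh]] _].
move=> /andP [/andP [gg _] _] /andP [/andP [gh _] _] [o Cg] [o2 Ch].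
exact: ciso_collapse n_gt2 gg gh Cg Ch lg lh.
Qed.

Definition bounded_count a b := class_count (fun g => lim true a g && lim false b g).

(** Twins are collapsed first: the leaf collapse then preserves the twin bound already imposed, by
    [lim_twin_collapse_leaf]. *)
Lemma bounded_count_rec a b i j S : wt i = a.+2 -> wt j = b.+2 -> i != j ->
    i \notin S -> j \notin S ->
  class_count xpredT S =
    bounded_count a b S + bounded_count a b (j |: S)
    + (bounded_count a b (i |: S) + bounded_count a b (j |: (i |: S))).
Proof.
move=> wi wj ij iS jS.
rewrite (class_count_collapse (tw := true) wi iS) //.
have leaf (T : {set K}) : j \notin T -> class_count (fun g => true && lim true a g) T =
    bounded_count a b T + bounded_count a b (j |: T).
  move=> jT; rewrite (class_count_collapse (tw := false) wj jT) // => g g' o gg C.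
  exact: lim_twin_collapse_leaf n_gt2 gg C.
by rewrite !leaf // !inE eq_sym (negPf ij).
Qed.

Lemma bounded_count_large a b S : n < #|S| -> bounded_count a b S = 0.
Proof.
move=> nS; apply: nclass0 => g; apply/negP => /andP [_ /eqP Sg].
suff : #|S| <= n by rewrite leqNgt nS.
have sub : S \subset pmap (fun u => if g.2 u is Some (Some k) then Some k else None) (enum 'I_n).
  apply/subsetP => k; rewrite -Sg inE => /existsP [u /eqP uk].
  by rewrite mem_pmap; apply/mapP; exists u; rewrite ?mem_enum // uk.
apply: leq_trans (subset_leq_card sub) _; apply: leq_trans (card_size _) _.
by rewrite size_pmap; apply: leq_trans (count_size _ _) _; rewrite size_enum_ord.
Qed.
End Recurrence.

(** * Symmetry by downward induction on the set of colours *)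

(** With [n.+1] colours of either weight, a fresh one of each kind exists whenever [S] has at most
    [n] elements; larger [S] give zero counts and start the induction. *)
Lemma bounded_count_sym n (a b : nat) : 2 < n ->
  let wt (k : bool * 'I_n.+1) := if k.1 then a.+2 else b.+2 in
  forall S, @bounded_count n _ wt a b S = @bounded_count n _ wt b a S.
Proof.
move=> n2 wt S.
have wt0 k : 0 < wt k by rewrite /wt; case: k.1.
have [d] := ubnP (n.+1 - #|S|); elim: d S => // d IH S dS.
have [nS|Sn] := ltnP n #|S|; first by rewrite !bounded_count_large.
have fresh (c : bool) : exists i, (c, i) \notin S.
  apply/existsP; apply: contraLR Sn; rewrite negb_exists => /forallP all.
  have E : #|pair c @: [set: 'I_n.+1]| = n.+1.
    by rewrite card_imset ?cardsT ?card_ord // => x y [].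
  rewrite -ltnNge; apply: leq_trans (eq_leq (esym E)) _.
  by apply/subset_leq_card/subsetP => _ /imsetP [i _ ->]; have := all i; rewrite negbK.
have [i iS] := fresh true; have [j jS] := fresh false.
(* The same unrestricted count is expanded twice, with the roles of the two fresh colours exchanged.
   By induction the three terms with larger colour sets agree, hence so does the fourth. *)
have := bounded_count_rec n2 wt0 (erefl (wt (true, i))) (erefl (wt (false, j))) isT iS jS.
rewrite (bounded_count_rec n2 wt0 (erefl (wt (false, j))) (erefl (wt (true, i))) isT jS iS).
have IH' k (T : {set _}) : k \notin T -> #|S| <= #|T| -> bounded_count n wt a b (k |: T) = bounded_count n wt b a (k |: T).
  by move=> kT ST; apply: IH; rewrite cardsU1 kT; lia.
have ijS : (true, i) \notin (false, j) |: S by rewrite !inE (negPf iS).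
have S_le : #|S| <= #|(false, j) |: S| by apply/subset_leq_card/subsetUr.
rewrite (setUCA [set (false, j)] [set (true, i)]) (IH' _ _ iS) // (IH' _ _ jS) // (IH' _ _ ijS S_le).
lia.
Qed.

(** * Return to uncoloured graphs and exact values *)

(** The count at level [m.+1] is the difference of two consecutive cumulative counts. *)
Lemma nclass_level (T : finType) (e : rel T) (P1 P2 : pred T) (f1 f2 : T -> nat) :
    equivalence_rel e -> (forall x y, e x y -> f1 x = f1 y) ->
    (forall x y, e x y -> f2 x = f2 y) ->
    (forall m, nclass e (fun x => P1 x && (f1 x <= m)) = nclass e (fun x => P2 x && (f2 x <= m))) ->
  forall m, nclass e (fun x => P1 x && (f1 x == m)) = nclass e (fun x => P2 x && (f2 x == m)).
Proof.
move=> eqe inv1 inv2 le12 [|m].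
  have := le12 0; congr (_ = _); apply: nclass_ext => x; by rewrite leqn0.
have rec P f : (forall x y, e x y -> f x = f y) ->
    nclass e (fun x => P x && (f x <= m.+1)) =
    nclass e (fun x => P x && (f x <= m)) + nclass e (fun x => P x && (f x == m.+1)).
  move=> inv; rewrite -nclassU //; last first.
    by move=> x y /inv -> fy; apply/eqP => fm; rewrite fm ltnn in fy.
  by apply: nclass_ext => x; congr (_ && _); lia.
have := le12 m.+1; rewrite (rec _ _ inv1) (rec _ _ inv2) le12; exact: addnI.
Qed.

Section Uncoloured.
Variable n : nat.
Implicit Types (G H : graph n) (u v w : 'I_n).

Definition monochrome K G : cgraph n K := (G, [ffun=> Some None]).

Lemma iso_monochrome (K : finType) G H : iso G H = ciso (monochrome K G) (monochrome K H).
Proof.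
apply: eq_existsb => p; apply: eq_forallb => u; by rewrite !ffunE eqxx.
Qed.

Lemma iso_equiv : equivalence_rel (@iso n).
Proof. by move=> G H L; rewrite !(iso_monochrome void); exact: ciso_equiv. Qed.

Lemma isoP G H : iso G H -> exists p : {perm 'I_n}, forall u v, adj G u v = adj H (p u) (p v).
Proof.
by case/existsP => p /forallP Hp; exists p => u v; have /forallP /(_ v) /eqP := Hp u.
Qed.

Lemma sibling_iso G H : iso G H -> sibling G = sibling H.
Proof.
case/isoP => p pa; rewrite /sibling [in RHS](reindex_inj (@perm_inj _ p)); congr _.-1.
apply: eq_bigr => v _; rewrite -[RHS](card_perm_set p); apply: eq_card => u; rewrite !inE.
by rewrite -!/(nb true _ _) !(nb_preim _ _ pa) (inj_eq (@preimset_perm_inj _ _)).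
Qed.

Lemma tuft_iso G H : iso G H -> tuft G = tuft H.
Proof.
case/isoP => p pa; rewrite /tuft [in RHS](reindex_inj (@perm_inj _ p)).
apply: eq_bigr => v _; rewrite -[RHS](card_perm_set p); apply: eq_card => u; rewrite !inE pa.
congr (_ && (_ == _)); rewrite -[RHS](card_perm_set p); apply: eq_card => w.
by rewrite !inE pa.
Qed.

Lemma sibling_le K a G : (sibling G <= a) = lim true a (monochrome K G).
Proof.
have E v : #|[set u | cnbhd G u == cnbhd G v]| =
    (#|[set u | plain (monochrome K G) u & link true (monochrome K G) u v]|).+1.
  rewrite (cardsD1 v) inE eqxx add1n; congr _.+1; apply: eq_card => u.
  by rewrite !inE /plain ffunE eqxx.
have -> : (sibling G <= a) = (\max_v #|[set u | cnbhd G u == cnbhd G v]| <= a.+1).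
  by rewrite /sibling -subn1 leq_subLR add1n.
apply/bigmax_leqP/forallP => H v; first by apply/implyP => _; rewrite -ltnS -E H.
by move=> _; rewrite E ltnS; have := H v; rewrite {1}/plain ffunE eqxx.
Qed.

Lemma tuft_le K b G : simple_graph G -> (tuft G <= b) = lim false b (monochrome K G).
Proof.
case/simpleP => _ sym.
have E v : [set u | adj G v u & is_leaf G u] =
    [set u | plain (monochrome K G) u & link false (monochrome K G) u v].
  apply/setP => u; rewrite !inE /plain ffunE eqxx /= sym -in_nbhd /is_leaf.
  apply/andP/eqP => [[vu /cards1P [x E]]|->]; last by rewrite set11 cards1.
  by move: vu; rewrite E => /set1P ->.
apply/bigmax_leqP/forallP => H v; first by apply/implyP => _; rewrite -E H.
by move=> _; rewrite E; have := H v; rewrite {1}/plain ffunE eqxx.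
Qed.

Lemma good_monochrome (K : finType) (wt : K -> nat) G :
  good wt (monochrome K G) = simple_graph G && connected_graph G.
Proof.
apply/goodP/andP => /= [[-> _ conn _]|[-> /forallP conn]]; split=> //.
- by apply/forallP => u; apply/forallP => v; apply: conn; rewrite ffunE.
- by move=> u v _; rewrite ffunE.
- by move=> u v _ _; have /forallP := conn u.
- rewrite (eq_bigr (fun=> 1)) ?sum1_card ?card_ord // => u _; by rewrite ffunE.
Qed.

Lemma used_monochrome K G : used (monochrome K G) = set0.
Proof. by apply/setP => k; rewrite !inE; apply/existsP => -[u]; rewrite ffunE. Qed.

(** Without colours every label has weight at most 1, and a total of [n] forces every label to be a
    vertex. *)
Lemma good_unused (K : finType) (wt : K -> nat) (g : cgraph n K) :
  good wt g -> used g = set0 -> g = monochrome K g.1.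
Proof.
case/goodP => _ _ _ wgt /setP u0; rewrite [LHS]surjective_pairing; congr (_, _).
have le1 u : colour_weight wt (g.2 u) <= 1.
  case gu: (g.2 u) => [[k|]|] //=; have := u0 k; rewrite !inE => /existsP []; exists u.
  exact/eqP.
apply/ffunP => u; rewrite ffunE.
have : \sum_u (1 - colour_weight wt (g.2 u)) = 0.
  rewrite sumnB; last by move=> v _; exact: le1.
  by rewrite sum1_card card_ord wgt subnn.
move/eqP; rewrite sum_nat_eq0 => /forallP /(_ u) /=.
case gu: (g.2 u) => [[k|]|] //= _.
by have := u0 k; rewrite !inE => /existsP []; exists u; exact/eqP.
Qed.

Lemma bounded_count_monochrome (K : finType) (wt : K -> nat) a b :
  nclass (@iso n) (fun G => [&& simple_graph G, connected_graph G, sibling G <= a & tuft G <= b])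
  = bounded_count n wt a b set0.
Proof.
have PE G : [&& simple_graph G, connected_graph G, sibling G <= a & tuft G <= b] =
    (good wt (monochrome K G) && (lim true a (monochrome K G) && lim false b (monochrome K G)))
    && (used (monochrome K G) == set0).
  rewrite good_monochrome used_monochrome eqxx andbT (sibling_le K).
  by have [sG|] //= := boolP (simple_graph G); rewrite (tuft_le K).
apply/eqP; rewrite eqn_leq; apply/andP; split.
  apply: (nclass_le (R := fun G g => g = monochrome K G)); [exact: iso_equiv|exact: ciso_equiv| |].
    by move=> G; rewrite PE => PG; exists (monochrome K G).
  by move=> G H g h _ _ _ _ -> ->; rewrite (iso_monochrome K).
apply: (nclass_le (R := fun g G => g = monochrome K G)); [exact: ciso_equiv|exact: iso_equiv| |].
  move=> g Qg; have := Qg; case/andP => /andP [/good_unused gE _] /eqP /gE {}gE.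
  by exists g.1; rewrite // PE -gE.
by move=> g h G H _ _ _ _ -> ->; rewrite (iso_monochrome K).
Qed.

(** Only the complete graphs on one and two vertices occur, and both numbers equal [n.-1]. This
    covers the orders excluded by [2 < n]. *)
Lemma small_sibling_tuft G : 0 < n <= 2 -> simple_graph G -> connected_graph G ->
  sibling G = tuft G.
Proof.
case/andP => n0 n2 /simpleP [irr sym] /forallP conn.
have two u v w : u != v -> w != u -> w = v.
  move=> /eqP uv /eqP wu; apply: val_inj => /=.
  have := ltn_ord u; have := ltn_ord v; have := ltn_ord w.
  have : val u <> val v by move/val_inj.
  have : val w <> val u by move/val_inj.
  rewrite /=; lia.
have aE u v : adj G u v = (u != v).
  case: eqVneq => [->|uv]; first exact: irr.
  have /forallP /(_ v) /connectP [[|x s] /=] := conn u; first by move=> _ E; rewrite E eqxx in uv.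
  case/andP => ux _ _; rewrite -(two u v x) //.
  by apply/eqP => E; rewrite E irr in ux.
have cT v : cnbhd G v = setT.
  by apply/setP => u; rewrite in_cnbhd aE inE eq_sym orbN.
have nb1 v : #|nbhd G v| = n.-1.
  rewrite -[in RHS](card_ord n) -cardsT (cardsD1 v) inE; apply: eq_card => u.
  by rewrite !inE aE eq_sym andbT.
pose v0 : 'I_n := Ordinal n0.
have maxE (F : 'I_n -> nat) c : (forall v, F v = c) -> \max_v F v = c.
  move=> Fc; apply/eqP; rewrite eqn_leq -{2}(Fc v0) leq_bigmax andbT.
  by apply/bigmax_leqP => v _; rewrite Fc.
have sE v : #|[set u | cnbhd G u == cnbhd G v]| = n.
  by rewrite -[RHS](card_ord n) -cardsT; apply: eq_card => u; rewrite !inE !cT eqxx.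
have tE v : #|[set u | adj G v u & is_leaf G u]| = n.-1.
  rewrite -[RHS](nb1 v); apply: eq_card => u; rewrite !inE /is_leaf nb1.
  have [|/eqP n1] := eqVneq n.-1 1; first by rewrite andbT.
  rewrite andbF aE; apply/esym/negbTE; rewrite negbK; apply/eqP/val_inj => /=.
  by have := ltn_ord u; have := ltn_ord v; lia.
by rewrite /sibling /tuft (maxE _ _ sE) (maxE _ _ tE).
Qed.
End Uncoloured.

Theorem theorem1p1 (n : nat) (hn : 1 <= n) (a b : nat) :
  count_classes n a b = count_classes n b a.
Proof.
have countE c d : count_classes n c d = nclass (@iso n)
    (fun G => [&& simple_graph G, connected_graph G, sibling G == c & tuft G == d]) by [].
have [n2|n3] := leqP n 2.
  rewrite !countE; apply: nclass_ext => G; case sG: (simple_graph G) => //=.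
  case cG: (connected_graph G) => //=; rewrite (small_sibling_tuft _ sG cG) ?hn //.
  exact: andbC.
have sym c d : nclass (@iso n) (fun G => [&& simple_graph G, connected_graph G, sibling G <= c & tuft G <= d])
             = nclass (@iso n) (fun G => [&& simple_graph G, connected_graph G, sibling G <= d & tuft G <= c]).
  pose wt (k : bool * 'I_n.+1) := if k.1 then c.+2 else d.+2.
  by rewrite !(bounded_count_monochrome n wt); exact: bounded_count_sym.
pose cg (G : graph n) := simple_graph G && connected_graph G.
(* Bounds become equalities one at a time: here the first with the second held fixed, and then the
   second through [H]. *)
have le_eq c d : nclass (@iso n) (fun G => (cg G && (tuft G <= d)) && (sibling G == c))
               = nclass (@iso n) (fun G => (cg G && (sibling G <= d)) && (tuft G == c)).
  apply: nclass_level => [|||m]; [exact: iso_equiv|exact: sibling_iso|exact: tuft_iso|].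
  have := sym m d; congr (_ = _); apply: nclass_ext => G; rewrite /cg -!andbA //.
  by rewrite [(sibling G <= m) && _]andbC.
have := @nclass_level _ (@iso n) (fun G => cg G && (sibling G == a)) (fun G => cg G && (tuft G == a))
  (@tuft n) (@sibling n) (@iso_equiv n) (@tuft_iso n) (@sibling_iso n).
rewrite !countE => H.
transitivity (nclass (@iso n) (fun G => (cg G && (sibling G == a)) && (tuft G == b))).
  by apply: nclass_ext => G; rewrite /cg -!andbA.
rewrite H => [|m].
  by apply: nclass_ext => G; rewrite /cg -!andbA [(tuft G == a) && _]andbC.
have := le_eq a m; congr (_ = _); apply: nclass_ext => G; rewrite /cg -!andbA.
  by rewrite [(tuft G <= m) && _]andbC.
by rewrite [(tuft G == a) && _]andbC.
Qed.
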